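(* Let $n\ge2$. All the homomorphisms induced by inclusions $$\tilde j_*:Q\mathcal{P}_{n-1}\to\mathcal{P}_{n-1},\qquad j_*:Q\mathcal{B}_{n-1}\to\mathcal{B}_{n-1},\qquad \tilde j_*:R\mathcal{P}_n\to\mathcal{P}_n,\qquad j_*:R\mathcal{B}_n\to\mathcal{B}_n$$ are surjective.
   Context: $\mathcal{F}_n\subset\mathbb{C}^n$ is the ordered configuration space of $n$ distinct points, $p:\mathcal{F}_n\to\mathcal{C}_n=\mathcal{F}_n/\Sigma_n$ the regular covering, $\mathcal{P}_n=\pi_1(\mathcal{F}_n)$, $\mathcal{B}_n=\pi_1(\mathcal{C}_n)$. $\mathcal{C}_n$ is identified with the space of monic degree $n$ complex polynomials with non-zero discriminant; $Q(X)=n\prod_{k=1}^{n-1}(X-\beta_k)$ with distinct roots is identified with $\{\beta_1,\dots,\beta_{n-1}\}\in\mathcal{C}_{n-1}$. $Q\mathcal{C}_{n-1}=\{Q=n\prod_{k=1}^{n-1}(X-\beta_k)\mid \beta_k\ne\beta_j,\ \int_{\beta_k}^{\beta_j}Q(t)dt\neq0\ \forall k\neq j\}\subset\mathcal{C}_{n-1}$, and $R\mathcal{C}_n=\{\int_0^XQ(t)dt-c\mid Q=n\prod(X-\beta_k)\in Q\mathcal{C}_{n-1},\ c\in\mathbb{C},\ c\ne\int_0^{\beta_k}Q(t)dt\ \forall k\}\subset\mathcal{C}_n$. Put $Q\mathcal{F}_{n-1}=p^{-1}(Q\mathcal{C}_{n-1})\subset\mathcal{F}_{n-1}$ and $R\mathcal{F}_n=p^{-1}(R\mathcal{C}_n)\subset\mathcal{F}_n$.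 The groups $Q\mathcal{P}_{n-1},Q\mathcal{B}_{n-1},R\mathcal{P}_n,R\mathcal{B}_n$ are the fundamental groups of $Q\mathcal{F}_{n-1},Q\mathcal{C}_{n-1},R\mathcal{F}_n,R\mathcal{C}_n$; $\tilde j$ and $j$ denote the respective inclusions into the (ordered, unordered) configuration spaces. *)

(* Defs.v *)
From HB Require Import structures.
From mathcomp Require Import all_boot all_order all_algebra generic_quotient.
From mathcomp Require Import perm.
From mathcomp Require Import complex.
From mathcomp Require Import all_classical all_reals all_analysis homotopy_theory.homotopy.
From mathcomp Require Import ring lra.
Import numFieldNormedType.Exports.

Set Implicit Arguments.
Unset Strict Implicit.
Unset Printing Implicit Defensive.
Import Order.TTheory GRing.Theory Num.Theory.

Local Open Scope classical_set_scope.
Local Open Scope ring_scope.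
Local Open Scope quotient_scope.

Definition unitI (R : realType) : Type := set_type `[0 : R, 1]%classic.

Section unit_interval.
Context {R : realType}.
Local Notation I := (unitI R).

HB.instance Definition _ := Topological.on I.

Definition clamp_real (r : R) : R := Order.max 0 (Order.min 1 r).

Definition uval (t : I) : R := \val t.

Lemma clamp_subproof (r : R) : clamp_real r \in `[0, 1]%classic.
Proof.
rewrite inE /= in_itv /= /clamp_real le_max lexx /= ge_max ler01 /=.
by rewrite ge_min lexx.
Qed.

Definition clamp (r : R) : I := exist _ (clamp_real r) (clamp_subproof r).
Arguments clamp : simpl never.
Arguments uval : simpl never.

Lemma uval_inj : injective uval. Proof. exact: val_inj. Qed.

Lemma unitI_ge0 (t : I) : 0 <= uval t.
Proof. by have := valP t; rewrite inE /= in_itv /= => /andP[]. Qed.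

Lemma unitI_le1 (t : I) : uval t <= 1.
Proof. by have := valP t; rewrite inE /= in_itv /= => /andP[]. Qed.

Lemma clampK (t : I) : clamp (uval t) = t.
Proof.
apply: val_inj; rewrite /clamp /uval /= /clamp_real.
by rewrite (min_idPr (unitI_le1 t)) (max_idPr (unitI_ge0 t)).
Qed.

Lemma clampE (r : R) : 0 <= r <= 1 -> uval (clamp r) = r.
Proof.
move=> /andP[r0 r1]; rewrite /uval /clamp /= /clamp_real.
by rewrite (min_idPr r1) (max_idPr r0).
Qed.

Lemma clamp_le0 (r : R) : r <= 0 -> clamp r = clamp 0.
Proof.
move=> r0; apply: uval_inj; rewrite [RHS]clampE ?lexx ?ler01// /uval /clamp /= /clamp_real.
by rewrite (min_idPr (le_trans r0 ler01)) (max_idPl r0).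
Qed.

Lemma clamp_ge1 (r : R) : 1 <= r -> clamp r = clamp 1.
Proof.
move=> r1; apply: uval_inj; rewrite [RHS]clampE ?lexx ?ler01// /uval /clamp /= /clamp_real.
by rewrite (min_idPl r1) (max_idPr ler01).
Qed.

Lemma clamp01_neq : clamp 0 != clamp 1.
Proof.
apply/eqP => /(congr1 uval).
by rewrite !clampE ?lexx ?ler01//; apply/eqP; rewrite eq_sym oner_eq0.
Qed.

HB.instance Definition _ := @isBiPointed.Build I (clamp 0) (clamp 1) clamp01_neq.

Lemma val_unitI_continuous : continuous uval.
Proof. exact: initial_continuous. Qed.

Lemma max_continuous (T : topologicalType) (u v : T -> R) :
  continuous u -> continuous v -> continuous (fun x => Order.max (u x) (v x)).
Proof. by move=> cu cv x; apply: continuous_max; [exact: cu|exact: cv]. Qed.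

Lemma min_continuous (T : topologicalType) (u v : T -> R) :
  continuous u -> continuous v -> continuous (fun x => Order.min (u x) (v x)).
Proof. by move=> cu cv x; apply: continuous_min; [exact: cu|exact: cv]. Qed.

Lemma clamp_continuous (T : topologicalType) (u : T -> R) :
  continuous u -> continuous (fun x => clamp (u x)).
Proof.
move=> cu; apply: continuous_comp_initial.
apply: max_continuous; first by move=> ?; exact: cvg_cst.
by apply: min_continuous => // ?; exact: cvg_cst.
Qed.

End unit_interval.

Section path_homotopy.
Context {R : realType} {T : topologicalType}.
Local Notation I := (unitI R).
Local Notation ipath x y := (@pathType I T x y).

(* Homotopy relative to the endpoints. *)
Definition path_homotopic (x y : T) (p q : ipath x y) : Prop :=
  exists H : I * I -> T,
    [/\ continuous H,
        forall t, H (zero, t) = p t,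
        forall t, H (one, t) = q t,
        forall s, H (s, zero) = x &
        forall s, H (s, one) = y].

Lemma paste_continuous (X : topologicalType) (u : X -> R) (c : R)
    (f g : X -> T) :
  continuous u -> continuous f -> continuous g ->
  (forall x, u x = c -> f x = g x) ->
  continuous (fun x => if u x <= c then f x else g x).
Proof.
move=> cu cf cg fg; apply/continuous_subspace_setT.
have -> : [set: X] = (u @^-1` [set r | r <= c]) `|` (u @^-1` [set r | c <= r]).
  by apply/seteqP; split=> // x _ /=; apply/orP; exact: le_total.
apply: withinU_continuous.
- by apply: closed_comp => [x _|]; [exact: cu|exact: closed_le].
- by apply: closed_comp => [x _|]; [exact: cu|exact: closed_ge].
- apply: (@subspace_eq_continuous _ _ _ f).
    by move=> x; rewrite inE /= => xc; rewrite /from_subspace xc.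
  exact: continuous_subspaceT.
- apply: (@subspace_eq_continuous _ _ _ g).
    move=> x; rewrite inE /from_subspace /= => cx; case: ifPn => // xc.
    by rewrite fg//; apply/le_anti; rewrite xc.
  exact: continuous_subspaceT.
Qed.

Lemma affine_continuous (X : topologicalType) (u : X -> R) (a b : R) :
  continuous u -> continuous (fun x => a * u x + b).
Proof.
by move=> cu x; apply: cvgD; [apply: cvgMr; exact: cu|exact: cvg_cst].
Qed.

Lemma onem_continuous (X : topologicalType) (u : X -> R) :
  continuous u -> continuous (fun x => 1 - u x).
Proof.
move=> cu x; apply: (@cvgB R R^o); first exact: cvg_cst.
exact: cu.
Qed.

Lemma val_continuous (X : topologicalType) (u : X -> I) :
  continuous u -> continuous (fun x => uval (u x)).
Proof.
by move=> cu x; apply: continuous_comp; [exact: cu|exact: val_unitI_continuous].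
Qed.

Lemma comp_continuous (X Y Z : topologicalType) (f : X -> Y) (g : Y -> Z) :
  continuous f -> continuous g -> continuous (fun x => g (f x)).
Proof. by move=> cf cg x; apply: continuous_comp; [exact: cf|exact: cg]. Qed.

Lemma pair_continuous (X Y Z : topologicalType) (f : X -> Y) (g : X -> Z) :
  continuous f -> continuous g -> continuous (fun x => (f x, g x)).
Proof. by move=> cf cg x; apply: cvg_pair; [exact: cf|exact: cg]. Qed.

Lemma fst_cont (X Y : topologicalType) : continuous (@fst X Y).
Proof. by move=> x; exact: cvg_fst. Qed.

Lemma snd_cont (X Y : topologicalType) : continuous (@snd X Y).
Proof. by move=> x; exact: cvg_snd. Qed.

Lemma path_homotopic_refl x y (p : ipath x y) : path_homotopic p p.
Proof.
exists (fun st => p st.2); split=> //= [|s|s]; rewrite ?path_zero ?path_one//.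
by apply: comp_continuous; [exact: snd_cont|exact: cts_fun].
Qed.

Lemma clamp0E : clamp 0 = zero :> I. Proof. by []. Qed.
Lemma clamp1E : clamp 1 = one :> I. Proof. by []. Qed.
Lemma val0E : uval (zero : I) = 0. Proof. by rewrite clampE ?lexx ?ler01. Qed.
Lemma val1E : uval (one : I) = 1. Proof. by rewrite clampE ?lexx ?ler01. Qed.

Lemma path_homotopic_sym x y (p q : ipath x y) :
  path_homotopic p q -> path_homotopic q p.
Proof.
move=> [H [cH H0 H1 Hx Hy]].
exists (fun st => H (clamp (- 1 * uval st.1 + 1), st.2)); split=> //= [|t|t].
- apply: comp_continuous => //; apply: pair_continuous; last exact: snd_cont.
  apply/clamp_continuous/affine_continuous/val_continuous; exact: fst_cont.
- by rewrite val0E mulr0 add0r clamp1E.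
- by rewrite val1E mulr1 addNr clamp0E.
Qed.

Lemma path_homotopic_trans x y (p q r : ipath x y) :
  path_homotopic p q -> path_homotopic q r -> path_homotopic p r.
Proof.
move=> [H [cH H0 H1 Hx Hy]] [K [cK K0 K1 Kx Ky]].
exists (fun st => if uval st.1 <= 2^-1 then H (clamp (2 * uval st.1 + 0), st.2)
                  else K (clamp (2 * uval st.1 + (-1)), st.2)); split.
- apply: paste_continuous.
  + by apply: val_continuous; exact: fst_cont.
  + apply: comp_continuous => //; apply: pair_continuous; last exact: snd_cont.
    by apply/clamp_continuous/affine_continuous/val_continuous; exact: fst_cont.
  + apply: comp_continuous => //; apply: pair_continuous; last exact: snd_cont.
    by apply/clamp_continuous/affine_continuous/val_continuous; exact: fst_cont.
  + move=> [s t] /= ->; rewrite mulfV ?pnatr_eq0// addr0 subrr.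
    by rewrite clamp1E clamp0E H1 K0.
- by move=> t /=; rewrite val0E invr_ge0 ler0n mulr0 addr0 clamp0E.
- move=> t /=; rewrite val1E ifF; last by apply/negbTE; lra.
  by rewrite clamp_ge1 ?clamp1E; last lra.
- by move=> s /=; case: ifP.
- by move=> s /=; case: ifP.
Qed.

Lemma path_homotopic_reparam x y (p q : ipath x y) (f : I -> T) (phi psi : I -> R) :
  continuous f -> continuous phi -> continuous psi ->
  (forall t, p t = f (clamp (phi t))) -> (forall t, q t = f (clamp (psi t))) ->
  phi zero = psi zero -> phi one = psi one -> path_homotopic p q.
Proof.
move=> cf cphi cpsi pE qE e0 e1.
exists (fun st => f (clamp
  ((1 - uval st.1) * phi st.2 + uval st.1 * psi st.2))).
split=> [|t|t|s|s] /=.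
- apply: comp_continuous => //; apply: clamp_continuous => st.
  have cv : continuous (fun st : I * I => uval st.1).
    by apply: val_continuous; exact: fst_cont.
  apply: cvgD; apply: cvgM.
  + by apply: cvgB; [exact: cvg_cst|exact: cv].
  + exact: (comp_continuous (@snd_cont _ _) cphi).
  + exact: cv.
  + exact: (comp_continuous (@snd_cont _ _) cpsi).
- by rewrite pE val0E mul0r addr0 subr0 mul1r.
- by rewrite qE val1E subrr mul0r add0r mul1r.
- by rewrite e0 -mulrDl subrK mul1r -e0 -pE path_zero.
- by rewrite e1 -mulrDl subrK mul1r -e1 -pE path_one.
Qed.

Section concat.
Context (x y z : T) (p : ipath x y) (q : ipath y z).

Definition concat_path (t : I) : T :=
  if uval t <= 2^-1 then p (clamp (2 * uval t + 0))
  else q (clamp (2 * uval t + (-1))).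

Lemma concat_path_continuous : continuous concat_path.
Proof.
apply: paste_continuous; first exact: val_unitI_continuous.
- apply: comp_continuous; last exact: cts_fun.
  by apply/clamp_continuous/affine_continuous; exact: val_unitI_continuous.
- apply: comp_continuous; last exact: cts_fun.
  by apply/clamp_continuous/affine_continuous; exact: val_unitI_continuous.
- move=> t ->; rewrite mulfV ?pnatr_eq0// addr0 subrr.
  by rewrite clamp1E clamp0E path_zero path_one.
Qed.

Lemma concat_path_zero : concat_path zero = x.
Proof.
by rewrite /concat_path val0E invr_ge0 ler0n mulr0 addr0 clamp0E path_zero.
Qed.

Lemma concat_path_one : concat_path one = z.
Proof.
rewrite /concat_path val1E ifF; last by apply/negbTE; lra.
by rewrite clamp_ge1 ?clamp1E ?path_one//; lra.
Qed.

HB.instance Definition _ :=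
  @isContinuous.Build I T concat_path concat_path_continuous.
HB.instance Definition _ :=
  @isPath.Build I T x z concat_path concat_path_zero concat_path_one.
End concat.

Section reverse.
Context (x y : T) (p : ipath x y).

Definition reverse_path (t : I) : T := p (clamp (1 - uval t)).

Lemma reverse_path_continuous : continuous reverse_path.
Proof.
apply: comp_continuous; last exact: cts_fun.
by apply/clamp_continuous/onem_continuous; exact: val_unitI_continuous.
Qed.

Lemma reverse_path_zero : reverse_path zero = y.
Proof. by rewrite /reverse_path val0E subr0 clamp1E path_one. Qed.

Lemma reverse_path_one : reverse_path one = x.
Proof. by rewrite /reverse_path val1E subrr clamp0E path_zero. Qed.

HB.instance Definition _ :=
  @isContinuous.Build I T reverse_path reverse_path_continuous.
HB.instance Definition _ :=
  @isPath.Build I T y x reverse_path reverse_path_zero reverse_path_one.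
End reverse.

Lemma concat_path_homotopic x y z (p p' : ipath x y) (q q' : ipath y z) :
  path_homotopic p p' -> path_homotopic q q' ->
  path_homotopic (concat_path p q) (concat_path p' q').
Proof.
move=> [H [cH H0 H1 Hx Hy]] [K [cK K0 K1 Kx Ky]].
exists (fun st => if uval st.2 <= 2^-1 then H (st.1, clamp (2 * uval st.2 + 0))
                  else K (st.1, clamp (2 * uval st.2 + (-1)))); split.
- apply: paste_continuous.
  + by apply: val_continuous; exact: snd_cont.
  + apply: comp_continuous => //; apply: pair_continuous; first exact: fst_cont.
    by apply/clamp_continuous/affine_continuous/val_continuous; exact: snd_cont.
  + apply: comp_continuous => //; apply: pair_continuous; first exact: fst_cont.
    by apply/clamp_continuous/affine_continuous/val_continuous; exact: snd_cont.
  + move=> [s t] /= ->; rewrite mulfV ?pnatr_eq0// addr0 subrr.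
    by rewrite clamp1E clamp0E Hy Kx.
- by move=> t /=; rewrite /concat_path H0 K0.
- by move=> t /=; rewrite /concat_path H1 K1.
- by move=> s /=; rewrite val0E invr_ge0 ler0n mulr0 addr0 clamp0E.
- move=> s /=; rewrite val1E ifF; last by apply/negbTE; lra.
  by rewrite clamp_ge1 ?clamp1E; last lra.
Qed.

Lemma reverse_path_homotopic x y (p q : ipath x y) :
  path_homotopic p q -> path_homotopic (reverse_path p) (reverse_path q).
Proof.
move=> [H [cH H0 H1 Hx Hy]].
exists (fun st => H (st.1, clamp (1 - uval st.2))); split.
- apply: comp_continuous => //; apply: pair_continuous; first exact: fst_cont.
  by apply/clamp_continuous/onem_continuous/val_continuous; exact: snd_cont.
- by move=> t; rewrite H0.
- by move=> t; rewrite H1.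
- by move=> s /=; rewrite val0E subr0 clamp1E.
- by move=> s /=; rewrite val1E subrr clamp0E.
Qed.

Let val_cont := @val_unitI_continuous R.

Lemma path_homotopic_reparam_clamp x y (p q : ipath x y) (f : I -> T)
    (phi psi : I -> R) :
  continuous f -> continuous phi -> continuous psi ->
  (forall t, p t = f (clamp (phi t))) -> (forall t, q t = f (clamp (psi t))) ->
  clamp (phi zero) = clamp (psi zero) -> clamp (phi one) = clamp (psi one) ->
  path_homotopic p q.
Proof.
move=> cf cphi cpsi pE qE e0 e1.
apply: (@path_homotopic_reparam _ _ _ _ f (fun t => uval (clamp (phi t)))
         (fun t => uval (clamp (psi t)))) => //.
- exact/val_continuous/clamp_continuous.
- exact/val_continuous/clamp_continuous.
- by move=> t; rewrite clampK.
- by move=> t; rewrite clampK.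
- by rewrite e0.
- by rewrite e1.
Qed.

Lemma concat_cst_path x y (p : ipath x y) :
  path_homotopic (concat_path (cst x) p) p.
Proof.
apply: (@path_homotopic_reparam_clamp _ _ _ _ p
         (fun t => 2 * uval t + (-1)) uval).
- exact: cts_fun.
- exact: affine_continuous.
- exact: val_cont.
- move=> t; rewrite /= /concat_path /=; case: ifPn => // t2.
  by rewrite clamp_le0 ?clamp0E ?path_zero//; lra.
- by move=> t; rewrite clampK.
- by rewrite val0E clamp_le0//; lra.
- by rewrite val1E; congr clamp; lra.
Qed.

Lemma concat_path_cst x y (p : ipath x y) :
  path_homotopic (concat_path p (cst y)) p.
Proof.
apply: (@path_homotopic_reparam_clamp _ _ _ _ p
         (fun t => 2 * uval t + 0) uval).
- exact: cts_fun.
- exact: affine_continuous.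
- exact: val_cont.
- move=> t; rewrite /= /concat_path /=; case: ifPn => // t2.
  by rewrite clamp_ge1 ?clamp1E ?path_one//; lra.
- by move=> t; rewrite clampK.
- by rewrite val0E; congr clamp; lra.
- by rewrite val1E clamp_ge1//; lra.
Qed.

Lemma concat_path_reverse x y (p : ipath x y) :
  path_homotopic (concat_path p (reverse_path p)) (cst x).
Proof.
apply: (@path_homotopic_reparam_clamp _ _ _ _ p
         (fun t => Order.min (2 * uval t + 0) (- 2 * uval t + 2)) (cst 0)).
- exact: cts_fun.
- by apply: min_continuous; apply: affine_continuous; exact: val_cont.
- exact: cst_continuous.
- move=> t; have := unitI_ge0 t; have := unitI_le1 t => t1 t0.
  rewrite /= /concat_path /= /reverse_path; case: ifPn => t2.
    by rewrite min_l //; lra.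
  rewrite clampE; last by apply/andP; split; lra.
  by rewrite min_r; [congr (p (clamp _)); lra|lra].
- by move=> t; rewrite /= clamp0E path_zero.
- by rewrite val0E min_l /=; [congr clamp; lra|lra].
- by rewrite val1E min_r /=; [congr clamp; lra|lra].
Qed.

Lemma concat_reverse_path x y (p : ipath x y) :
  path_homotopic (concat_path (reverse_path p) p) (cst y).
Proof.
apply: (@path_homotopic_reparam_clamp _ _ _ _ p
         (fun t => Order.max (- 2 * uval t + 1) (2 * uval t + (-1))) (cst 1)).
- exact: cts_fun.
- by apply: max_continuous; apply: affine_continuous; exact: val_cont.
- exact: cst_continuous.
- move=> t; have := unitI_ge0 t; have := unitI_le1 t => t1 t0.
  rewrite /= /concat_path /= /reverse_path; case: ifPn => t2.
    rewrite clampE; last by apply/andP; split; lra.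
    by rewrite max_l; [congr (p (clamp _)); lra|lra].
  by rewrite max_r //; lra.
- by move=> t; rewrite /= clamp1E path_one.
- by rewrite val0E max_l /=; [congr clamp; lra|lra].
- by rewrite val1E max_r /=; [congr clamp; lra|lra].
Qed.

Lemma concat_pathA x y z w (p : ipath x y) (q : ipath y z) (r : ipath z w) :
  path_homotopic (concat_path p (concat_path q r))
                 (concat_path (concat_path p q) r).
Proof.
apply: (@path_homotopic_reparam_clamp _ _ _ _ (concat_path (concat_path p q) r)
  (fun t => Order.max (2^-1 * uval t + 0)
     (Order.max (1 * uval t + (- 4^-1)) (2 * uval t + (-1)))) uval).
- exact: concat_path_continuous.
- by do 2?[apply: max_continuous]; apply: affine_continuous; exact: val_cont.
- exact: val_cont.
- move=> t; have := unitI_ge0 t; have := unitI_le1 t => t1 t0 /=.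
  have [t2|t2] := leP (uval t) 2^-1.
    rewrite max_l; last by rewrite ge_max; apply/andP; split; lra.
    rewrite /concat_path /= /concat_path t2 clampE; last by apply/andP; split; lra.
    rewrite ifT; last lra.
    rewrite clampE; last by apply/andP; split; lra.
    by rewrite ifT; [congr (p (clamp _)); lra|lra].
  rewrite max_r; last by rewrite le_max; apply/orP; left; lra.
  rewrite {1}/concat_path /= leNgt t2 /= /concat_path.
  rewrite clampE; last by apply/andP; split; lra.
  have [t3|t3] := leP (2 * uval t + -1) 2^-1.
    rewrite max_l; last by lra.
    rewrite clampE; last by apply/andP; split; lra.
    rewrite ifT; last lra.
    rewrite /= /concat_path clampE; last by apply/andP; split; lra.
    rewrite ifF; last by apply/negbTE; lra.
    by congr (q (clamp _)); lra.
  rewrite max_r; last by lra.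
  rewrite clampE; last by apply/andP; split; lra.
  rewrite ifF; last by apply/negbTE; lra.
  by congr (r (clamp _)); lra.
- by move=> t; rewrite clampK.
- rewrite val0E max_l; first by congr clamp; lra.
  by rewrite ge_max; apply/andP; split; lra.
- rewrite val1E max_r; last by rewrite le_max; apply/orP; left; lra.
  by rewrite max_r; [congr clamp; lra|lra].
Qed.

End path_homotopy.

Section fundamental_group.
Context (R : realType) (T : topologicalType) (x : T).

Definition loop := {path unitI R from x to x in T}.

Definition loop_homotopic : rel loop := fun p q => `[< path_homotopic p q >].

Lemma loop_homotopic_equiv : equiv_class_of loop_homotopic.
Proof.
split=> [p|p q|q p r].
- by apply/asboolP; exact: path_homotopic_refl.
- by apply: asbool_equiv_eq; split; exact: path_homotopic_sym.
- move=> /asboolP pq /asboolP qr; apply/asboolP.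
  exact: path_homotopic_trans pq qr.
Qed.

Canonical loop_homotopic_equivRel := EquivRelPack loop_homotopic_equiv.

Definition pi1 : Type := {eq_quot loop_homotopic_equivRel}.
HB.instance Definition _ := Choice.on pi1.
HB.instance Definition _ := EqQuotient.on pi1.

Lemma pi1_eqP (p q : loop) :
  (\pi_pi1 p = \pi_pi1 q) <-> path_homotopic p q.
Proof.
split=> [/eqmodP/asboolP //|pq].
by apply/eqmodP/asboolP.
Qed.

Lemma repr_pi1 (p : loop) : path_homotopic (repr (\pi_pi1 p)) p.
Proof. by apply/pi1_eqP; rewrite reprK. Qed.

Definition pi1_mul (a b : pi1) : pi1 := \pi_pi1 (concat_path (repr a) (repr b)).
Definition pi1_one : pi1 := \pi_pi1 (cst x).
Definition pi1_inv (a : pi1) : pi1 := \pi_pi1 (reverse_path (repr a)).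

Lemma pi1_mulE (p q : loop) :
  pi1_mul (\pi_pi1 p) (\pi_pi1 q) = \pi_pi1 (concat_path p q).
Proof. by apply/pi1_eqP/concat_path_homotopic; exact: repr_pi1. Qed.

Lemma pi1_invE (p : loop) : pi1_inv (\pi_pi1 p) = \pi_pi1 (reverse_path p).
Proof. by apply/pi1_eqP/reverse_path_homotopic; exact: repr_pi1. Qed.

Lemma pi1_mulA : associative pi1_mul.
Proof.
elim/quotW => p; elim/quotW => q; elim/quotW => r.
rewrite (pi1_mulE q r) (pi1_mulE p q) (pi1_mulE p _) (pi1_mulE _ r).
by apply/pi1_eqP; exact: concat_pathA.
Qed.

Lemma pi1_mul1g : left_id pi1_one pi1_mul.
Proof.
elim/quotW => p; rewrite pi1_mulE; apply/pi1_eqP; exact: concat_cst_path.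
Qed.

Lemma pi1_mulg1 : right_id pi1_one pi1_mul.
Proof.
elim/quotW => p; rewrite pi1_mulE; apply/pi1_eqP; exact: concat_path_cst.
Qed.

Lemma pi1_mulVg : left_inverse pi1_one pi1_inv pi1_mul.
Proof.
elim/quotW => p; rewrite pi1_invE pi1_mulE; apply/pi1_eqP.
exact: concat_reverse_path.
Qed.

Lemma pi1_mulgV : right_inverse pi1_one pi1_inv pi1_mul.
Proof.
elim/quotW => p; rewrite pi1_invE pi1_mulE; apply/pi1_eqP.
exact: concat_path_reverse.
Qed.

HB.instance Definition _ :=
  isGroup.Build pi1 pi1_mulA pi1_mul1g pi1_mulg1 pi1_mulVg pi1_mulgV.

End fundamental_group.
Section induced_morphism.
Context (R : realType) (T U : topologicalType) (f : continuousType T U) (x : T).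

Definition pi1_map (a : pi1 R x) : pi1 R (f x) :=
  \pi_(pi1 R (f x)) (f \o repr a).

Lemma comp_path_homotopic (p q : loop R x) :
  path_homotopic p q ->
  path_homotopic (f \o p : loop R (f x)) (f \o q : loop R (f x)).
Proof.
move=> [H [cH H0 H1 Hx Hy]]; exists (f \o H); split => /= [|t|t|s|s].
- by apply: comp_continuous => //; exact: cts_fun.
- by rewrite H0.
- by rewrite H1.
- by rewrite Hx.
- by rewrite Hy.
Qed.

Lemma pi1_mapE (p : loop R x) :
  pi1_map (\pi_(pi1 R x) p) = \pi_(pi1 R (f x)) (f \o p).
Proof. by apply/pi1_eqP/comp_path_homotopic; exact: repr_pi1. Qed.

Lemma pi1_map_mul : {morph pi1_map : a b / (a * b)%g}.
Proof.
elim/quotW => p; elim/quotW => q.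
transitivity (pi1_map (\pi_(pi1 R x) (concat_path p q))).
  by congr pi1_map; exact: pi1_mulE.
rewrite (pi1_mapE p) (pi1_mapE q) (pi1_mapE (concat_path p q)).
apply: etrans (esym (pi1_mulE (f \o p) (f \o q))).
congr (\pi_(pi1 R (f x)) _).
by apply/path_eqP => t /=; rewrite /concat_path /=; case: ifP.
Qed.

HB.instance Definition _ := isMultiplicative.Build _ _ pi1_map pi1_map_mul.

End induced_morphism.
Arguments pi1_map R {T U} f x a.

Section inclusion.
Context (T : topologicalType) (A : set T).

Definition inclusion : A -> T := set_val.

Lemma inclusion_continuous : continuous inclusion.
Proof. exact: initial_continuous. Qed.

HB.instance Definition _ := isContinuous.Build A T inclusion inclusion_continuous.

End inclusion.
Arguments inclusion {T} A _.

(* Gives R[i] the topology of its complex modulus. *)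
HB.instance Definition _ (R : realType) := NormedModule.copy R[i] (R[i])^o.

Section configuration_spaces.
Context (R : realType) (n : nat).
Local Notation C := R[i].

Definition ordered_config : Type :=
  set_type [set z : 'rV[C]_n | injective (z ord0)].
HB.instance Definition _ := Topological.on ordered_config.

Definition config_perm : rel ordered_config :=
  fun z w => [exists s : 'S_n, \val w == col_perm s (\val z)].

Lemma config_perm_equiv : equiv_class_of config_perm.
Proof.
split=> [z|z w|w z u].
- by apply/existsP; exists 1%g; rewrite col_perm1.
- apply/existsP/existsP => -[s /eqP zw]; exists s^-1%g; apply/eqP.
    by rewrite zw -col_permM mulVg col_perm1.
  by rewrite zw -col_permM mulVg col_perm1.
- move=> /existsP[s /eqP zs] /existsP[t /eqP ut].
  by apply/existsP; exists (t * s)%g; rewrite ut zs -col_permM.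
Qed.

Canonical config_perm_equivRel := EquivRelPack config_perm_equiv.

Definition unordered_config : Type :=
  quotient_topology {eq_quot config_perm_equivRel}.
HB.instance Definition _ := Topological.on unordered_config.
HB.instance Definition _ := Quotient.on unordered_config.

Definition config_proj (z : ordered_config) : unordered_config :=
  \pi_unordered_config z.

Definition config_poly (z : ordered_config) : {poly C} :=
  \prod_(k < n) ('X - (\val z ord0 k)%:P).

End configuration_spaces.

(* The complex line integral of f along the segment from a to b; on polynomials
   it does not depend on the path from a to b. *)
Definition line_integral (R : realType) (f : R[i] -> R[i]) (a b : R[i]) : R[i] :=
  let g (t : R) := f (a + (t%:C)%C * (b - a)) * (b - a) in
  (\int[lebesgue_measure]_(t in `[0, 1]) complex.Re (g t) +i*
   \int[lebesgue_measure]_(t in `[0, 1]) complex.Im (g t))%C.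

(* Below, b ranges over F_(n-1) and lists the roots of the polynomial
   Q = n (X - b_1) ... (X - b_(n-1)); the class of b stands for Q, and a monic
   polynomial of degree n with distinct roots is represented by the unordered
   configuration of its roots. *)
Section subspaces.
Context (R : realType) (n : nat).
Local Notation C := R[i].

Definition derivative_poly (b : ordered_config R n.-1) : {poly C} :=
  n%:R *: config_poly b.

Definition QC : set (unordered_config R n.-1) :=
  [set q | exists2 b : ordered_config R n.-1, q = config_proj b &
    forall k j, k != j ->
      line_integral (horner (derivative_poly b))
        (\val b ord0 k) (\val b ord0 j) != 0].

Definition RC : set (unordered_config R n) :=
  [set r | exists (b : ordered_config R n.-1) (c : C) (z : ordered_config R n),
    [/\ QC (config_proj b),
        forall k, c != line_integral (horner (derivative_poly b)) 0
                         (\val b ord0 k),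
        forall X, (config_poly z).[X] =
                    line_integral (horner (derivative_poly b)) 0 X - c &
        r = config_proj z]].

Definition QF : set (ordered_config R n.-1) := @config_proj R n.-1 @^-1` QC.

Definition RF : set (ordered_config R n) := @config_proj R n @^-1` RC.

End subspaces.
Arguments derivative_poly R n b : clear implicits.
Arguments QC R n : clear implicits.
Arguments RC R n : clear implicits.
Arguments QF R n : clear implicits.
Arguments RF R n : clear implicits.

(* Main.v *)
(* On a complex line through one of their points, QF and RF contain every
   configuration outside the zeros of a nonzero polynomial in the line
   coordinate. Indeed the product over k != j of the integrals of Q from b_k to
   b_j is a polynomial in b; being symmetric, it is also a polynomial in the
   coefficients of Q, that is of P' when b lists the critical points of P.

   Any path with ends in such a subset is cut into short pieces, whose ends are
   moved into the subset. A short piece is homotopic to a parabolic arc in the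
   complex line through its ends, and all but finitely many of these arcs avoid
   the zeros of the polynomial. In the unordered case the short pieces are
   first lifted to ordered configurations, the projection being open and
   locally injective. *)

From HB Require Import structures.
From mathcomp Require Import all_boot all_order all_algebra generic_quotient perm.
From mathcomp Require Import separable complex.
From mathcomp Require Import -(notations) mpoly.
From mathcomp Require Import all_classical all_reals all_analysis homotopy_theory.homotopy.
From mathcomp Require Import ring lra.
Require Import Defs.
Import numFieldNormedType.Exports.

Set Implicit Arguments.
Unset Strict Implicit.
Unset Printing Implicit Defensive.
Import Order.TTheory GRing.Theory Num.Theory.

Local Open Scope classical_set_scope.
Local Open Scope ring_scope.
Local Open Scope quotient_scope.

(** * Homotopies into a subset *)

(** The step is applied at the supremum of the points of [0, 1] where [E] holds: a point of this set
    close to it carries [E] past the supremum, up to 1. *)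
Lemma unit_interval_induction (R : realType) (E : R -> Prop) :
  E 0 ->
  (forall t, exists2 e, 0 < e &
     forall s u, t - e < s -> s <= u -> u < t + e -> E s -> E u) ->
  E 1.
Proof.
move=> E0 step; pose S := [set t : R | 0 <= t <= 1 /\ E t].
have S0 : S 0 by split => //; rewrite lexx ler01.
have S1 : ubound S 1 by move=> t [/andP[]].
have hS : has_sup S by split; [exists 0|exists 1].
have [e e0 he] := step (sup S).
have [s [/andP[s0 s1] Es] ms] := sup_adherent e0 hS.
have sm : s <= sup S by apply: ub_le_sup; [exact: hS.2|split => //; rewrite s0].
have [m1|m1] := leP 1 (sup S + e / 2).
  by apply: he Es => //; lra.
have : sup S + e / 2 <= sup S.
  apply: ub_le_sup; first exact: hS.2.
  by split; [apply/andP; split; lra|apply: he Es => //; lra].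
by lra.
Qed.

Lemma add_continuous (K : numFieldType) (V : normedModType K)
    (X : topologicalType) (u v : X -> V) :
  continuous u -> continuous v -> continuous (fun x => u x + v x).
Proof. by move=> cu cv x; apply: cvgD; [exact: cu|exact: cv]. Qed.

Section homotopy_into_subset.
Context {R : realType} {T : topologicalType}.
Local Notation I := (unitI R).
Local Notation ipath x y := (@pathType I T x y).
Implicit Types (V : set T) (x y z : T).

Lemma path_homotopic_eq x y (p q : ipath x y) : p =1 q -> path_homotopic p q.
Proof. by move=> /path_eqP ->; exact: path_homotopic_refl. Qed.

Definition homotopic_into V x y (p : ipath x y) :=
  exists2 q : ipath x y, path_homotopic p q & forall t, V (q t).

(** Endpoints belong to the type of a path, so paths that are equal as functions may still have
    different types. *)
Lemma homotopic_into_eq V x y x' y' (p : ipath x y) (p' : ipath x' y') :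
  p =1 p' -> homotopic_into V p' -> homotopic_into V p.
Proof.
move=> pp'.
have ex : x = x' by rewrite -(path_zero (s := p)) pp' path_zero.
have ey : y = y' by rewrite -(path_one (s := p)) pp' path_one.
subst x' y' => -[q p'q Vq]; exists q => //.
by apply: path_homotopic_trans p'q; exact: path_homotopic_eq.
Qed.

Lemma homotopic_into_homotopic V x y (p p' : ipath x y) :
  path_homotopic p p' -> homotopic_into V p' -> homotopic_into V p.
Proof.
by move=> pp' [q p'q Vq]; exists q => //; exact: path_homotopic_trans p'q.
Qed.

Lemma homotopic_into_concat V x y z (p : ipath x y) (q : ipath y z) :
  homotopic_into V p -> homotopic_into V q ->
  homotopic_into V (concat_path p q).
Proof.
move=> [p' pp' Vp'] [q' qq' Vq']; exists (concat_path p' q').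
  exact: concat_path_homotopic.
by move=> t; rewrite /= /concat_path; case: ifP.
Qed.

Lemma concat_path_sub (N : set T) x y z (p : ipath x y) (q : ipath y z) :
  (forall t, N (p t)) -> (forall t, N (q t)) ->
  forall t, N (concat_path p q t).
Proof. by move=> Np Nq t; rewrite /concat_path; case: ifP. Qed.

Section subpath.
Context (g : continuousType I T) (s u : R).

Definition subpath (t : I) : T := g (clamp ((u - s) * uval t + s)).

Lemma subpath_continuous : continuous subpath.
Proof.
apply: comp_continuous; last exact: cts_fun.
by apply/clamp_continuous/affine_continuous; exact: val_unitI_continuous.
Qed.

Lemma subpath_zero : subpath zero = g (clamp s).
Proof. by rewrite /subpath val0E mulr0 add0r. Qed.

Lemma subpath_one : subpath one = g (clamp u).
Proof. by rewrite /subpath val1E mulr1 subrK. Qed.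

HB.instance Definition _ := @isContinuous.Build I T subpath subpath_continuous.
HB.instance Definition _ :=
  @isPath.Build I T (g (clamp s)) (g (clamp u)) subpath subpath_zero subpath_one.
End subpath.

Lemma concat_subpath (g : continuousType I T) (s u v : R) :
  path_homotopic (concat_path (subpath g s u) (subpath g u v))
                 (subpath g s v).
Proof.
apply: (@path_homotopic_reparam _ _ _ _ _ _ g
  (* This runs from [s] to [u] and then to [v]: the first summand stops at [t = 1/2], where the
     second one starts. *)
  (fun t => ((u - s) * Order.min 1 (2 * uval t + 0) + s)
            + ((v - u) * Order.max 0 (2 * uval t + -1) + 0))
  (fun t => (v - s) * uval t + s)).
- exact: cts_fun.
- apply: add_continuous; apply: affine_continuous.
    apply: (@Defs.min_continuous _ _ (cst 1) (fun t => 2 * uval t + 0)).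
      exact: cst_continuous.
    by apply: affine_continuous; exact: val_unitI_continuous.
  apply: (@Defs.max_continuous _ _ (cst 0) (fun t => 2 * uval t + -1)).
    exact: cst_continuous.
  by apply: affine_continuous; exact: val_unitI_continuous.
- by apply: affine_continuous; exact: val_unitI_continuous.
- move=> t; have := unitI_ge0 t; have := unitI_le1 t => t1 t0 /=.
  rewrite /concat_path /= /subpath; case: ifPn => t2.
    rewrite clampE; last by apply/andP; split; lra.
    by rewrite min_r ?max_l; [congr (g (clamp _)); ring|lra|lra].
  rewrite clampE; last by apply/andP; split; lra.
  by rewrite min_l ?max_r; [congr (g (clamp _)); ring|lra|lra].
- by [].
- by rewrite val0E min_r ?max_l; [ring|lra|lra].
- by rewrite val1E min_l ?max_r; [ring|lra|lra].
Qed.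

(** The path [d] followed by its reverse contracts; this moves a cut point [y] to the end [v] of
    [d]. *)
Lemma concat_path_insert x y z w v (p : ipath x y) (q : ipath y z)
    (e : ipath z w) (d : ipath y v) :
  path_homotopic (concat_path (concat_path p q) e)
    (concat_path (concat_path p d)
       (concat_path (reverse_path d) (concat_path q e))).
Proof.
apply: path_homotopic_trans (path_homotopic_sym (concat_pathA p q e)) _.
apply: path_homotopic_trans (concat_pathA p d _).
apply: concat_path_homotopic; first exact: path_homotopic_refl.
apply: path_homotopic_sym.
apply: path_homotopic_trans (concat_pathA _ _ _) _.
apply: path_homotopic_trans (concat_cst_path _).
apply: concat_path_homotopic; last exact: path_homotopic_refl.
exact: concat_path_reverse.
Qed.

Theorem local_homotopic_into V :
  (forall y W, nbhs y W ->
     exists z (p : ipath y z), V z /\ forall t, W (p t)) ->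
  (forall y, exists N, [/\ open N, N y &
     forall x z (p : ipath x z), V x -> V z -> (forall t, N (p t)) ->
       homotopic_into V p]) ->
  forall x z (p : ipath x z), V x -> V z -> homotopic_into V p.
Proof.
move=> escape local x z p Vx Vz.
(* The point of [p] at time [t] may lie outside [V], so the induction concerns the initial piece of
   [p] completed by any path into [V] that stays in a small [W]. *)
pose E (t : R) := exists2 W, nbhs (p (clamp t)) W &
  forall z' (d : ipath (p (clamp t)) z'), V z' -> (forall r, W (d r)) ->
    homotopic_into V (concat_path (subpath p 0 t) d).
have pcl : continuous (fun r : R => p (clamp r)).
  apply: comp_continuous; last exact: cts_fun.
  by apply: clamp_continuous => ?; exact: cvg_id.
suff [W pW hW] : E 1.
  apply: (@homotopic_into_eq _ _ _ _ _ _ (subpath p 0 1)).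
    by move=> t; rewrite /= /subpath subr0 mul1r addr0 clampK.
  apply: homotopic_into_homotopic (path_homotopic_sym (concat_path_cst _)) _.
  apply: hW => [|r /=]; first by rewrite -(path_one (s := p)) in Vz.
  exact: nbhs_singleton pW.
apply: unit_interval_induction.
  have [N [oN Ny hN]] := local (p (clamp 0)).
  exists N; first exact: open_nbhs_nbhs.
  move=> z' d Vz' Nd; apply: hN => //; first by rewrite -(path_zero (s := p)) in Vx.
  by apply: concat_path_sub => // t; rewrite /= /subpath subrr mul0r add0r.
move=> t; have [N [oN Ny hN]] := local (p (clamp t)).
have /pcl/nbhs_ballP[e /= e0 he] : nbhs (p (clamp t)) N by exact: open_nbhs_nbhs.
have {}he r : t - e < r -> r < t + e -> N (p (clamp r)).
  move=> r1 r2; apply: he; rewrite /ball /= ltr_norml; apply/andP; split; lra.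
exists e => // s u ts su ut [W pW hW].
have Nsu r : N (subpath p s u r).
  have := unitI_ge0 r; have := unitI_le1 r => r1 r0.
  have a1 : 0 <= (u - s) * uval r by apply: mulr_ge0 => //; lra.
  have a2 : (u - s) * uval r <= (u - s) * 1 by apply: ler_wpM2l => //; lra.
  by apply: he; lra.
exists N; first by apply: open_nbhs_nbhs; split => //; apply: he; lra.
move=> z' d Vz' Nd.
(* The path [c] leads from the cut point into [V] inside both [W] and [N]: [E s] treats the piece
   ending with [c], and the rest, back along [c] and on through [d], stays in [N]. *)
have [v [c [Vv WNc]]] : exists v (c : ipath (p (clamp s)) v),
    V v /\ forall r, (W `&` N) (c r).
  apply: escape; apply: filterI => //; apply: open_nbhs_nbhs.
  by split => //; apply: he; lra.
apply: (@homotopic_into_homotopic _ _ _ _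
  (concat_path (concat_path (subpath p 0 s) (subpath p s u)) d)).
  apply: concat_path_homotopic; last exact: path_homotopic_refl.
  exact/path_homotopic_sym/concat_subpath.
apply: homotopic_into_homotopic (concat_path_insert _ _ _ c) _.
apply: homotopic_into_concat; first by apply: hW => // r; case: (WNc r).
apply: hN => //; apply: concat_path_sub.
  by move=> r; rewrite /= /reverse_path; case: (WNc (clamp (1 - uval r))).
exact: concat_path_sub.
Qed.

Lemma homotopic_into_comp (X : topologicalType) (f : continuousType X T) V
    (x y : X) (p : {path I from x to y in X}) (q : {path I from x to y in X}) :
  path_homotopic p q -> (forall t, V (f (q t))) ->
  homotopic_into V (f \o p : ipath (f x) (f y)).
Proof.
move=> [H [cH H0 H1 Hx Hy]] Vq; exists (f \o q) => //.
exists (f \o H); split=> [|t|t|s|s] /=; rewrite ?H0 ?H1 ?Hx ?Hy//.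
by apply: comp_continuous => //; exact: cts_fun.
Qed.

(** The deformed loop has values in [V], so it is a loop of the subspace, and its class is the
    required preimage. *)
Lemma pi1_inclusion_surj V (b : V) :
  (forall p : ipath (inclusion V b) (inclusion V b), homotopic_into V p) ->
  set_surj [set: pi1 R b] [set: pi1 R (inclusion V b)]
    (pi1_map R (inclusion V) b).
Proof.
move=> hV; elim/quotW => p _.
have [q pq Vq] := hV p.
pose r (t : I) : V := exist _ (q t) (mem_set (Vq t)).
have cr : continuous r by apply: continuous_comp_initial; exact: cts_fun.
have r0 : r zero = b by apply: val_inj; rewrite /= path_zero.
have r1 : r one = b by apply: val_inj; rewrite /= path_one.
exists (\pi_(pi1 R b) (mk_path cr r0 r1)) => //.
rewrite pi1_mapE; apply/pi1_eqP/path_homotopic_sym.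
by apply: path_homotopic_trans pq _; exact: path_homotopic_eq.
Qed.

End homotopy_into_subset.

(** * The discriminant of the critical values *)

Section critical_discriminant.
Context (F : numFieldType).

(* The coefficient of index 0 vanishes because [0^-1 = 0]. *)
Definition primitive (K : comNzRingType) (iota : {rmorphism F -> K})
    (p : {poly K}) : {poly K} :=
  \poly_(i < (size p).+1) (iota i%:R^-1 * p`_i.-1).

Lemma coef_primitive (K : comNzRingType) (iota : {rmorphism F -> K}) p i :
  (primitive iota p)`_i = iota i%:R^-1 * p`_i.-1.
Proof.
rewrite coef_poly; case: ltnP => // pi.
by rewrite nth_default ?mulr0// -ltnS (ltn_predK pi).
Qed.

Lemma map_primitive (K L : comNzRingType) (iota : {rmorphism F -> K})
    (f : {rmorphism K -> L}) p :
  map_poly f (primitive iota p) = primitive (f \o iota) (map_poly f p).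
Proof.
by apply/polyP => i; rewrite coef_map /= !coef_primitive coef_map rmorphM.
Qed.

Lemma deriv_primitive (p : {poly F}) : (primitive idfun p)^`() = p.
Proof.
apply/polyP => i; rewrite coef_deriv coef_primitive /= -[LHS]mulr_natl mulrA.
by rewrite mulfV ?mul1r// pnatr_eq0.
Qed.

Definition critical_poly (n m : nat) (K : comNzRingType) (b : 'I_m -> K) :
  {poly K} := n%:R *: \prod_(k < m) ('X - (b k)%:P).

(* The product over [k != j] of the integrals of [critical_poly n b] from [b k]
   to [b j]; [iota] provides the coefficients [i^-1] of the primitive, so that
   [b] may have entries in a ring of polynomials over [F]. *)
Definition critical_disc (n m : nat) (K : comNzRingType)
    (iota : {rmorphism F -> K}) (b : 'I_m -> K) : K :=
  let W := primitive iota (critical_poly n b) in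
  \prod_(kj : 'I_m * 'I_m | kj.1 != kj.2) (W.[b kj.2] - W.[b kj.1]).

(** Applied to permutations of indeterminates, to substitution of values for them, and to evaluation
    at a point of a line. *)
Lemma critical_disc_morph n m (K L : comNzRingType)
    (iota : {rmorphism F -> K}) (f : {rmorphism K -> L}) (b : 'I_m -> K) :
  f (critical_disc n iota b) = critical_disc n (f \o iota) (f \o b).
Proof.
rewrite rmorph_prod; apply: eq_bigr => kj _ /=.
rewrite rmorphB -!horner_map map_primitive map_polyZ rmorph_nat rmorph_prod.
by congr (_ .[_] - _.[_]); congr (primitive _ (_ *: _)); apply: eq_bigr => k _;
  rewrite rmorphB /= map_polyX map_polyC.
Qed.

Lemma critical_disc_eq n m (K : comNzRingType)
    (iota iota' : {rmorphism F -> K}) (b b' : 'I_m -> K) :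
  iota =1 iota' -> b =1 b' ->
  critical_disc n iota b = critical_disc n iota' b'.
Proof.
move=> ii bb; have -> : b = b' by apply/funext.
apply: eq_bigr => kj _; suff -> : primitive iota = primitive iota' by [].
by apply/funext => p; apply/polyP => i; rewrite !coef_primitive ii.
Qed.

Lemma critical_poly_perm n m (K : comNzRingType) (b : 'I_m -> K) (s : 'S_m) :
  critical_poly n (b \o s) = critical_poly n b.
Proof.
congr (_ *: _); rewrite [RHS](reindex_inj (@perm_inj _ s)).
exact: eq_bigr.
Qed.

Lemma critical_disc_perm n m (K : comNzRingType)
    (iota : {rmorphism F -> K}) (b : 'I_m -> K) (s : 'S_m) :
  critical_disc n iota (b \o s) = critical_disc n iota b.
Proof.
rewrite /critical_disc critical_poly_perm.
rewrite [RHS](reindex_inj (h := fun kj => (s kj.1, s kj.2))).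
  by apply: eq_bigl => kj; rewrite (inj_eq perm_inj).
by move=> [k j] [k' j'] [/perm_inj -> /perm_inj ->].
Qed.

Lemma critical_disc_neq0 n m (b : 'I_m -> F) :
  critical_disc n idfun b != 0 <->
  forall k j, k != j ->
    (primitive idfun (critical_poly n b)).[b j] !=
    (primitive idfun (critical_poly n b)).[b k].
Proof.
split=> [/prodf_neq0 d k j kj|d].
  by rewrite -subr_eq0; exact: (d (k, j)).
by apply/prodf_neq0 => -[k j] /= kj; rewrite subr_eq0 d.
Qed.

(* Symmetric, hence a polynomial in the elementary symmetric functions of [b],
   which are the coefficients of the monic polynomial with roots [b]. *)
Lemma critical_disc_coef n m :
  exists t : mpoly m F, forall b : 'I_m -> F,
    critical_disc n idfun b =
    meval (fun i : 'I_m =>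
      (-1) ^+ i.+1 * (\prod_(k < m) ('X - (b k)%:P))`_(m - i.+1)) t.
Proof.
pose X (k : 'I_m) : mpoly m F := mpolyX F (mnm1 k).
pose D := critical_disc n (@mpolyC m F) X.
have symD : D \is symmetric.
  apply/issymP => s.
  rewrite (critical_disc_morph _ _ (msym s)) -[RHS](critical_disc_perm _ _ _ s).
  apply: critical_disc_eq => [c|k] /=; first exact: mmapC.
  by rewrite /X /msym mmapX mmap1U.
have [t [tD _]] := sym_fundamental symD.
exists t => b; rewrite -[LHS](_ : meval b D = _); last first.
  rewrite (critical_disc_morph _ _ (meval b)).
  apply: critical_disc_eq => [c|k] /=; first exact: mevalC.
  by rewrite mevalXU.
rewrite -tD comp_mpoly_meval; apply: meval_eq => i.
rewrite tnth_mktuple.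
have := mroots_coeff (mktuple b) (Ordinal (ltn_ord i : i.+1 < m.+1)%N).
rewrite big_tuple /=; under eq_bigr do rewrite tnth_mktuple.
(* The coefficient equals the elementary symmetric function up to the sign already present, and the
   two signs cancel. *)
move=> ->; rewrite mulrA -exprD addnn -signr_odd odd_double mul1r.
by apply: meval_eq => k; rewrite tnth_mktuple.
Qed.
End critical_discriminant.

(** * Line integrals of polynomials *)

Section line_integral_polynomial.
Context (R : realType).
Local Notation C := R[i].

Lemma Rintegral_deriv_poly (u : {poly R}) :
  \int[lebesgue_measure]_(t in `[0, 1]) u^`().[t] = u.[1] - u.[0].
Proof.
rewrite /Rintegral (@continuous_FTC2 _ (horner u^`()) (horner u)) ?ltr01//.
- by apply: continuous_subspaceT; exact: continuous_horner.
- split; first by move=> x _; exact: derivable_horner.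
    by apply: cvg_at_right_filter; exact: continuous_horner.
  by apply: cvg_at_left_filter; exact: continuous_horner.
- by move=> x _; rewrite derivE.
Qed.

(** Powers of a real [t] are real scalars, so a real-linear [f] acts on the coefficients alone. For
    the real and imaginary parts this reduces the integrals to real polynomials. *)
Lemma horner_map_additive (f : C -> R) (p : {poly C}) (t : R) :
  {morph f : x y / x + y} -> (forall z (s : R), f (z * (s%:C)%C) = f z * s) ->
  f p.[(t%:C)%C] = (map_poly f p).[t].
Proof.
move=> fD fM.
have f0 : f 0 = 0 by have := fM 0 0; rewrite mul0r mulr0.
rewrite horner_coef (big_morph f fD f0).
rewrite (@horner_coef_wide _ (size p)); last exact: size_poly.
apply: eq_bigr => i _; rewrite coef_map_id0// -fM.
by congr (f (_ * _)); rewrite rmorphXn.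
Qed.

Lemma map_deriv_additive (f : C -> R) (p : {poly C}) :
  {morph f : x y / x + y} -> map_poly f p^`() = (map_poly f p)^`().
Proof.
move=> fD.
have f0 : f 0 = 0 by apply: (addrI (f 0)); rewrite -fD !addr0.
apply/polyP => i; rewrite coef_map_id0// !coef_deriv coef_map_id0//.
by move: (p`_i.+1) => c; elim: i.+1 => [|k IH]; rewrite ?mulr0n// !mulrS fD IH.
Qed.

Lemma line_integral_horner (p W : {poly C}) (a b : C) :
  W^`() = p -> line_integral (horner p) a b = W.[b] - W.[a].
Proof.
(* [G] is [W] along the segment; by the chain rule its derivative is the integrand. *)
move=> Wp; pose G := W \Po (a%:P + (b - a) *: 'X).
have GE z : G^`().[z] = p.[a + z * (b - a)] * (b - a).
  rewrite deriv_comp Wp derivD derivC add0r derivZ derivX.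
  by rewrite hornerM horner_comp !hornerE /= mulr1 (mulrC z).
have part (f : C -> R) : {morph f : x y / x + y} ->
    (forall z (s : R), f (z * (s%:C)%C) = f z * s) ->
    \int[lebesgue_measure]_(t in `[0, 1])
      f (p.[a + (t%:C)%C * (b - a)] * (b - a)) = f (W.[b] - W.[a]).
  move=> fD fM; transitivity (\int[lebesgue_measure]_(t in `[0, 1])
      ((map_poly f G)^`().[t] : R)).
    apply: eq_Rintegral => t _.
    by rewrite -GE horner_map_additive// map_deriv_additive.
  rewrite Rintegral_deriv_poly -!horner_map_additive// !horner_comp !hornerE.
  rewrite /= [a + b]addrC addrK.
  by apply/eqP; rewrite subr_eq -fD subrK.
rewrite /line_integral part; [|by case=> ? ? [? ?]|by case=> ? ? ? /=; ring].
rewrite part; [|by case=> ? ? [? ?]|by case=> ? ? ? /=; ring].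
by case: (_ - _).
Qed.

End line_integral_polynomial.

(** * Lines of configurations *)

Section line_density.
Context (R : realType).
Local Notation C := R[i].

Lemma horner_inj (K : numFieldType) (p q : {poly K}) :
  (forall x, p.[x] = q.[x]) -> p = q.
Proof.
move=> pq; apply/eqP; rewrite -subr_eq0; apply/eqP.
apply: (@roots_geq_poly_eq0 _ _ [seq i%:R | i <- iota 0 (size (p - q))]).
- by apply/allP => x _; rewrite rootE !hornerE pq subrr.
- rewrite map_inj_uniq ?iota_uniq// => i j /eqP.
  by rewrite eqr_nat => /eqP.
- by rewrite size_map size_iota.
Qed.

Lemma config_projP m (z w : ordered_config R m) :
  config_proj z = config_proj w <-> exists s, \val z = col_perm s (\val w).
Proof.
split=> [/esym/eqmodP/existsP[s /eqP zs]|[s zs]]; first by exists s.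
apply/esym/eqmodP/existsP; exists s; exact/eqP.
Qed.

Lemma config_poly_proj m (z w : ordered_config R m) :
  config_proj z = config_proj w -> config_poly z = config_poly w.
Proof.
move=> /config_projP[s zs]; rewrite /config_poly zs.
rewrite [RHS](reindex_inj (@perm_inj _ s)).
by apply: eq_bigr => k _; rewrite mxE.
Qed.

(** The discriminant is a polynomial in the coefficients by [critical_disc_coef]. This covers
    families with repeated entries, such as lists of critical points. *)
Lemma critical_disc_prod n m (b b' : 'I_m -> C) :
  \prod_(k < m) ('X - (b k)%:P) = \prod_(k < m) ('X - (b' k)%:P) ->
  critical_disc n idfun b = critical_disc n idfun b'.
Proof.
have [t tE] := critical_disc_coef C n m.
by move=> bb'; rewrite !tE bb'.
Qed.

Lemma line_integral_critical_disc n m (b : 'I_m -> C) :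
  (forall k j, k != j ->
    line_integral (horner (critical_poly n b)) (b k) (b j) != 0) <->
  critical_disc n idfun b != 0.
Proof.
rewrite critical_disc_neq0; split=> h k j kj.
  by rewrite -subr_eq0 -(line_integral_horner _ _ (deriv_primitive _)) h.
by rewrite (line_integral_horner _ _ (deriv_primitive _)) subr_eq0 h.
Qed.

(** [QC] asks for some ordering of the roots, but all orderings have the same monic polynomial,
    hence the same discriminant. *)
Lemma QFP n (z : ordered_config R n.-1) :
  QF R n z <-> critical_disc n idfun (\val z ord0) != 0.
Proof.
split=> [[b /config_poly_proj zb]|zd].
  move=> /line_integral_critical_disc; congr (_ != 0).
  exact: critical_disc_prod.
by exists z => //; apply/line_integral_critical_disc.
Qed.

Lemma config_poly_root_deriv m (z : ordered_config R m) (x : C) :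
  (config_poly z).[x] = 0 -> (config_poly z)^`().[x] != 0.
Proof.
have : separable_poly (\prod_(x <- codom (\val z ord0)) ('X - x%:P)).
  rewrite separable_prod_XsubC; apply/injectiveP.
  by have := valP z; rewrite inE.
rewrite separable_poly.unlock big_image => /coprimep_root h /eqP rx; exact: h.
Qed.

Lemma critical_poly_inj n m (b b' : 'I_m -> C) : (0 < n)%N ->
  critical_poly n b = critical_poly n b' ->
  \prod_(k < m) ('X - (b k)%:P) = \prod_(k < m) ('X - (b' k)%:P).
Proof. by move=> n0; apply: scalerI; rewrite pnatr_eq0 -lt0n. Qed.

(** A nonzero discriminant forces the critical points [b] to be distinct, so they form a
    configuration; the condition on the constant [c] then expresses that the roots of the polynomial
    are simple. *)
Lemma RFP n (z : ordered_config R n) (b : 'I_n.-1 -> C) : (0 < n)%N ->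
  (config_poly z)^`() = critical_poly n b ->
  RF R n z <-> critical_disc n idfun b != 0.
Proof.
move=> n0 zb; split.
  move=> [d [c [w [/QFP dd _ wE /config_poly_proj zw]]]].
  suff <- : critical_disc n idfun (\val d ord0) = critical_disc n idfun b by [].
  apply: critical_disc_prod; apply: (critical_poly_inj n0).
  rewrite -zb zw; pose W := primitive idfun (derivative_poly R n d).
  have -> : config_poly w = W - (W.[0] + c)%:P.
    apply: horner_inj => x.
    by rewrite wE (line_integral_horner _ _ (deriv_primitive _)) !hornerE; ring.
  by rewrite derivB derivC subr0 deriv_primitive.
move=> bd.
have binj : injective b.
  move=> k j bkj; apply/eqP; apply: contraTT bd => kj.
  apply/negP => /critical_disc_neq0 /(_ _ _ kj).
  by rewrite bkj eqxx.
have wP : (\row_k b k : 'rV[C]_n.-1) \in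
    [set z : 'rV[C]_n.-1 | injective (z ord0)].
  by rewrite inE /= => k j; rewrite !mxE => /binj.
pose w : ordered_config R n.-1 := exist _ (\row_k b k) wP.
have wb : \val w ord0 = b by apply/funext => k; rewrite /w /= mxE.
have intW x : line_integral (horner (derivative_poly R n w)) 0 x =
    (config_poly z).[x] - (config_poly z).[0].
  by apply: line_integral_horner; rewrite zb -wb.
(* The primitive vanishing at 0 is the polynomial of [z] minus its value at 0, which fixes [c]. *)
exists w, (- (config_poly z).[0]), z; split => //.
- by apply/QFP; rewrite wb.
(* Equality would make a critical point a root of the polynomial of [z]. *)
- move=> k; rewrite intW -subr_eq0 opprB addKr oppr_eq0.
  apply/eqP => /config_poly_root_deriv /negP; apply.
  rewrite zb wb hornerZ horner_prod (bigD1 k)//= hornerXsubC subrr.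
  by rewrite mul0r mulr0.
- by move=> x; rewrite intW opprK subrK.
Qed.

(** The derivative has leading coefficient [n], nonzero in characteristic 0, and splits over the
    complex numbers, possibly with repeated roots. *)
Lemma exists_critical_points n (z : ordered_config R n) : (0 < n)%N ->
  exists b : 'I_n.-1 -> C, (config_poly z)^`() = critical_poly n b.
Proof.
move=> n0; have Pm : config_poly z \is monic by exact: monic_prod_XsubC.
have Ps : size (config_poly z) = n.+1.
  by rewrite size_prod_XsubC /index_enum -enumT size_enum_ord.
have dn : (config_poly z)^`()`_n.-1 = n%:R.
  rewrite coef_deriv prednK//.
  by have := Pm; rewrite monicE lead_coefE Ps => /eqP ->.
have ds : size (config_poly z)^`() = n.
  apply/eqP; rewrite eqn_leq -ltnS -Ps lt_size_deriv ?monic_neq0//=.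
  rewrite leqNgt -[X in (_ < X)%N](prednK n0) ltnS.
  apply/negP => /leq_sizeP/(_ _ (leqnn _))/eqP.
  by rewrite dn pnatr_eq0 -leqn0 leqNgt n0.
have dl : lead_coef (config_poly z)^`() = n%:R by rewrite lead_coefE ds.
have [r] := closed_field_poly_normal (config_poly z)^`(); rewrite dl => rE.
have rs : size r = n.-1.
  move: ds; rewrite rE size_scale; last by rewrite pnatr_eq0 -lt0n.
  by rewrite size_prod_XsubC => <-.
exists (fun k => r`_k); rewrite rE /critical_poly.
by rewrite (big_nth 0) rs big_mkord.
Qed.

(** The parameter [s] is complex, with [a] at 0 and [b] at 1. The vector [a] is arbitrary, and only
    those points of the line that are configurations are concerned. *)
Definition line_dense m (V : set (ordered_config R m)) :=
  forall (a : 'rV[C]_m) (b : ordered_config R m), V b ->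
  exists2 g : {poly C}, g != 0 &
    forall (z : ordered_config R m) s,
      \val z = a + s *: (\val b - a) -> g.[s] != 0 -> V z.

Definition line_coord m (a b : 'rV[C]_m) (k : 'I_m) : {poly C} :=
  (a ord0 k)%:P + (b ord0 k - a ord0 k) *: 'X.

Lemma line_coordE m (a b : 'rV[C]_m) k s :
  (line_coord a b k).[s] = (a + s *: (b - a)) ord0 k.
Proof. by rewrite !hornerE /= !mxE mulrC. Qed.

(** The discriminant of the coordinate polynomials is a polynomial in [s], nonzero at [s = 1]
    because [b] lies in [QF]. *)
Lemma QF_line_dense n : line_dense (QF R n).
Proof.
move=> a b /QFP bd.
pose g := critical_disc n (@polyC C) (line_coord a (\val b)).
have gE s : g.[s] = critical_disc n idfun ((a + s *: (\val b - a)) ord0).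
  rewrite -[LHS]/(horner_eval s g) (critical_disc_morph _ _ (horner_eval s)).
  apply: critical_disc_eq => [c|k] /=; first by rewrite /horner_eval hornerC.
  by rewrite /horner_eval line_coordE.
exists g; last by move=> z s zE; rewrite gE -zE => /QFP.
apply: contraNneq bd => g0; have := gE 1.
by rewrite g0 horner0 scale1r addrC subrK => <-.
Qed.

(** Critical points need not vary polynomially along the line, but the coefficients of the
    derivative do, and [critical_disc_coef] expresses the discriminant through them. *)
Lemma RF_line_dense n : (0 < n)%N -> line_dense (RF R n).
Proof.
move=> n0 a b bR.
have [t tE] := critical_disc_coef C n n.-1.
(* The coefficients of [P] are polynomials in the line coordinate; [h] lists, with signs, those of
   its derivative divided by [n]. *)
pose P := \prod_(k < n) ('X - (line_coord a (\val b) k)%:P).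
pose h (i : 'I_n.-1) : {poly C} :=
  ((-1) ^+ i.+1 * n%:R^-1)%:P * P^`()`_(n.-1 - i.+1).
have gE (z : ordered_config R n) s : \val z = a + s *: (\val b - a) ->
    (mmap polyC h t).[s] != 0 <-> RF R n z.
  move=> zE; have [c cE] := exists_critical_points z n0.
  rewrite (RFP n0 cE) tE.
  suff -> : (mmap polyC h t).[s] = meval (fun i : 'I_n.-1 => (-1) ^+ i.+1 *
      (\prod_(k < n.-1) ('X - (c k)%:P))`_(n.-1 - i.+1)) t by [].
  have zP : config_poly z = map_poly (horner_eval s) P.
    rewrite rmorph_prod; apply: eq_bigr => k _.
    rewrite rmorphB /= map_polyX map_polyC /= /horner_eval.
    by rewrite line_coordE zE.
  have hE i : (h i).[s] = (-1) ^+ i.+1 *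
      (\prod_(k < n.-1) ('X - (c k)%:P))`_(n.-1 - i.+1).
    rewrite hornerM hornerC -mulrA; congr (_ * _).
    rewrite -[X in _ * X]/(horner_eval s _) -coef_map -deriv_map -zP cE coefZ.
    by rewrite mulKf// pnatr_eq0 -lt0n.
  rewrite mevalE /mmap horner_sum; apply: eq_bigr => k _.
  rewrite hornerM hornerC; congr (_ * _); rewrite /mmap1 horner_prod.
  by apply: eq_bigr => i _; rewrite horner_exp hE.
exists (mmap polyC h t); last by move=> z s /gE zE /zE.
have bE : \val b = a + 1 *: (\val b - a) by rewrite scale1r addrC subrK.
have : (mmap polyC h t).[1] != 0 by apply/(gE b 1 bE).
by apply: contraNneq => ->; rewrite horner0.
Qed.
End line_density.

(** * Avoiding the zeros of a polynomial *)

Section row_norm.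
Context (R : realType) (m : nat).
Local Notation C := R[i].
Implicit Types (u v : 'rV[C]_m) (t : R).

(* The library's norm on complex row vectors takes its values in [R[i]]. *)
Definition row_norm v : R := complex.Re `|v|.

Lemma row_normE v : `|v| = ((row_norm v)%:C)%C.
Proof. by rewrite /row_norm RRe_real// ger0_real. Qed.

Lemma row_norm_ge0 v : 0 <= row_norm v.
Proof. by rewrite -ler0c -row_normE. Qed.

Lemma row_normD u v : row_norm (u + v) <= row_norm u + row_norm v.
Proof. rewrite -lecR rmorphD /= -!row_normE. exact: ler_normD. Qed.

Lemma row_normZ (c : C) v : row_norm (c *: v) = complex.Re `|c| * row_norm v.
Proof.
have cE : ((complex.Re `|c|)%:C)%C = `|c| by rewrite RRe_real// ger0_real.
apply: (@complexI R); rewrite -row_normE normrZ row_normE -{1}cE.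
exact/esym/rmorphM.
Qed.

Lemma row_normZr t v : 0 <= t -> row_norm ((t%:C)%C *: v) = t * row_norm v.
Proof. by move=> t0; rewrite row_normZ ger0_norm// ler0c. Qed.

Lemma row_normZi t v : 0 <= t ->
  row_norm (((t%:C)%C * 'i%C) *: v) = t * row_norm v.
Proof.
move=> t0; rewrite row_normZ normrM (ger0_norm (x := (t%:C)%C)) ?ler0c//.
by rewrite normc_def /= expr0n expr1n add0r sqrtr1 mulr0 subr0 mulr1.
Qed.

Lemma nbhs_row_normP v (A : set 'rV[C]_m) : nbhs v A ->
  exists2 e : R, 0 < e & forall u, row_norm (u - v) < e -> A u.
Proof.
move=> /nbhs_normP[e /= e0 eA].
have eE : ((complex.Re e)%:C)%C = e by rewrite RRe_real// gtr0_real.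
exists (complex.Re e); first by rewrite -ltcR eE.
by move=> u; rewrite -ltcR -row_normE eE distrC => /eA.
Qed.

Lemma row_norm_nbhs v (e : R) : 0 < e ->
  nbhs v [set u | row_norm (u - v) < e].
Proof.
move=> e0; apply/(nbhs_normP v); exists (e%:C)%C; first by rewrite /= ltcR.
by move=> u; rewrite /= distrC row_normE ltcR.
Qed.

End row_norm.

Section continuity.
Context (R : realType).
Local Notation C := R[i].

Lemma real_complex_continuous (X : topologicalType) (u : X -> R) :
  continuous u -> continuous (fun x => ((u x)%:C)%C : C).
Proof.
move=> cu x; apply/cvgrPdist_lt => e e0.
have eE : ((complex.Re e)%:C)%C = e by rewrite RRe_real// gtr0_real.
have /cvgrPdist_lt/(_ (complex.Re e)) := cu x.
rewrite -ltcR eE => /(_ e0); apply: filterS => y.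
rewrite -rmorphB normc_def /= expr0n addr0 sqrtr_sqr.
by rewrite -ltcR eE.
Qed.

Lemma scale_map_continuous (X : topologicalType) (K : numFieldType)
    (V : normedModType K) (u : X -> K) (v : X -> V) :
  continuous u -> continuous v -> continuous (fun x => u x *: v x).
Proof. by move=> cu cv x; apply: cvgZ; [exact: cu|exact: cv]. Qed.

Lemma mul_map_continuous (X : topologicalType) (K : numFieldType)
    (u v : X -> K) :
  continuous u -> continuous v -> continuous (fun x => u x * v x).
Proof. by move=> cu cv x; apply: cvgM; [exact: cu|exact: cv]. Qed.

End continuity.

Section avoidance.
Context (R : realType).
Local Notation C := R[i].

Lemma exists_small_notin (s : seq R) (d : R) : 0 < d ->
  exists2 e, 0 < e < d & e \notin s.
Proof.
(* Infinitely many distinct values; the shift by 2 keeps them strictly below [d]. *)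
move=> d0; pose f (k : nat) : R := d / k.+2%:R.
have f_inj : injective f.
  move=> i j /(mulfI (lt0r_neq0 d0))/invr_inj/eqP.
  by rewrite eqr_nat => /eqP[].
have : ~ {subset [seq f k | k <- iota 0 (size s).+1] <= s}.
  move=> /uniq_leq_size; rewrite map_inj_uniq// iota_uniq => /(_ isT).
  by rewrite size_map size_iota ltnn.
move=> /existsNP[_ /not_implyP[/mapP[k _ ->] /negP fs]].
exists (f k) => //; apply/andP; split; first exact: divr_gt0.
by rewrite /f ltr_pdivrMr// ltr_pMr// ltr1n.
Qed.

Lemma roots_seq (g : {poly C}) : g != 0 ->
  exists r : seq C, forall z, g.[z] = 0 -> z \in r.
Proof.
move=> g0; have [r rE] := closed_field_poly_normal g; exists r => z gz.
rewrite -root_prod_XsubC; move: (gz); rewrite {1}rE hornerZ => /eqP.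
by rewrite mulf_eq0 lead_coef_eq0 (negbTE g0).
Qed.

(** Parabolic arcs from 0 to 1; two of them with different [e] meet only at these ends. *)
Definition detour (e t : R) : C := ((t%:C) + ((e * (t * (1 - t)))%:C) * 'i)%C.

Lemma detour_avoids (g : {poly C}) (d : R) : g != 0 -> 0 < d ->
  exists2 e, 0 < e < d & forall t, t != 0 -> t != 1 -> g.[detour e t] != 0.
Proof.
(* A given root lies on [detour e] for at most one [e], its [slope]. *)
move=> /roots_seq[r rP] d0.
pose slope (z : C) := complex.Im z / (complex.Re z * (1 - complex.Re z)).
have [e ed er] := exists_small_notin [seq slope z | z <- r] d0.
exists e => // t t0 t1; apply: contra er => /eqP/rP tr.
apply/mapP; exists (detour e t) => //; rewrite /slope /detour /=.
have t1' : 1 - t != 0 by rewrite subr_eq0 eq_sym.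
by field; rewrite t1' t0.
Qed.

Lemma small_real_avoids (g : {poly C}) (d : R) : g != 0 -> 0 < d ->
  exists2 e, 0 < e < d & g.[(e%:C)%C] != 0.
Proof.
move=> /roots_seq[r rP] d0.
have [e ed er] := exists_small_notin [seq complex.Re z | z <- r] d0.
exists e => //; apply: contra er => /eqP/rP tr.
by apply/mapP; exists (e%:C)%C.
Qed.

End avoidance.

(** * Ordered configurations *)

Section ordered_config_topology.
Context (R : realType) (m : nat).
Local Notation C := R[i].
Local Notation I := (unitI R).
Local Notation O := (ordered_config R m).
Local Notation ipath x y := (@pathType I O x y).

Lemma val_config_continuous : continuous (fun z : O => \val z : 'rV[C]_m).
Proof. exact: initial_continuous. Qed.

Lemma config_val_inj (z : O) : injective (\val z ord0).
Proof. by have := valP z; rewrite inE. Qed.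

Lemma config_nbhsP (y : O) W : nbhs y W ->
  exists2 e : R, 0 < e & forall z : O, row_norm (\val z - \val y) < e -> W z.
Proof.
move=> [_ /= [[B oB <-]] By BW].
have /nbhs_row_normP[e e0 eB] : nbhs (\val y : 'rV[C]_m) B.
  exact: open_nbhs_nbhs.
by exists e => // z /eB; exact: BW.
Qed.

(** Two vectors are compared for two purposes: equal vectors show that everything near [y] is a
    configuration, and two orderings of one configuration give local injectivity of the
    projection. *)
Lemma config_separated (y : O) :
  exists2 e : R, 0 < e & forall u v : 'rV[C]_m,
    row_norm (u - \val y) < e -> row_norm (v - \val y) < e ->
    forall i j, i != j -> u ord0 i != v ord0 j.
Proof.
pose y2 := (\val y : 'rV[C]_m, \val y : 'rV[C]_m).
pose d (i j : 'I_m) (uv : 'rV[C]_m * 'rV[C]_m) := uv.1 ord0 i - uv.2 ord0 j.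
have cd i j : continuous (d i j).
  move=> uv; apply: (@cvgB C C^o).
    apply: (continuous_comp (f := fst) (g := fun u : 'rV[C]_m => u ord0 i)).
      exact: cvg_fst.
    exact: coord_continuous.
  apply: (continuous_comp (f := snd) (g := fun u : 'rV[C]_m => u ord0 j)).
    exact: cvg_snd.
  exact: coord_continuous.
have : \forall uv \near y2, forall ij : 'I_m * 'I_m, ij.1 != ij.2 ->
    d ij.1 ij.2 uv != 0.
  apply: (@filter_forall _ _ (fun (ij : 'I_m * 'I_m) uv =>
    ij.1 != ij.2 -> d ij.1 ij.2 uv != 0) _ (nbhs_filter y2)) => -[i j] /=.
  have [_|ij] := eqVneq i j.
    by apply: (@filterE _ _ (nbhs_filter y2)).
  have d0 : d i j y2 != 0.
    by rewrite subr_eq0; apply: contraNneq ij => /config_val_inj ->.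
  have := cvgr_neq0 (V := C^o) (d i j y2) (cd i j y2) d0.
  move=> /(_ (nbhs_filter y2)).
  by apply: (@filterS _ _ (nbhs_filter y2)) => uv + _.
move=> [[A B] /= [/nbhs_row_normP[a a0 aA] /nbhs_row_normP[b b0 bB]] AB].
exists (Num.min a b); first by rewrite lt_min a0.
move=> u v; rewrite !lt_min => /andP[/aA Au _] /andP[_ /bB Bv] i j ij.
by rewrite -subr_eq0; exact: (AB (u, v) _ (i, j)).
Qed.

Lemma lift_config (X : topologicalType) (h : X -> 'rV[C]_m) :
  continuous h -> (forall x, injective (h x ord0)) ->
  exists2 h' : X -> O, continuous h' & forall x, \val (h' x) = h x.
Proof.
move=> ch hinj.
exists (fun x => exist _ (h x) (mem_set (hinj x))) => //.
exact: continuous_comp_initial.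
Qed.

Lemma separated_injective (y : O) (e : R) :
  (forall u v : 'rV[C]_m,
    row_norm (u - \val y) < e -> row_norm (v - \val y) < e ->
    forall i j, i != j -> u ord0 i != v ord0 j) ->
  forall u : 'rV[C]_m, row_norm (u - \val y) < e -> injective (u ord0).
Proof.
move=> sep u ue i j uij; apply/eqP; apply: contraT => /(sep _ _ ue ue).
by rewrite uij eqxx.
Qed.

(** Follow the segment from [y] towards [v] up to a small real parameter [e] that is not a zero of
    [g]. *)
Lemma line_dense_escape (V : set O) (v : O) : line_dense V -> V v ->
  forall y W, nbhs y W ->
    exists z (p : ipath y z), V z /\ forall t, W (p t).
Proof.
move=> dV Vv y W /config_nbhsP[a a0 aW].
have [b b0 /separated_injective bI] := config_separated y.
have [g g0 gV] := dV (\val y) v Vv.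
(* Dividing by [N + 1] rather than [N] includes the case where [v] is [y]. *)
pose N := row_norm (\val v - \val y); have N0 : 0 <= N := row_norm_ge0 _.
have N1 : 0 < N + 1 by rewrite ltr_wpDl.
have ab0 : 0 < Num.min a b by rewrite lt_min a0.
have [e /andP[e0]] := small_real_avoids g0 (divr_gt0 ab0 N1).
rewrite ltr_pdivlMr// => eN ge.
pose h (t : I) := \val y + ((e * uval t + 0)%:C)%C *: (\val v - \val y).
have hb t : row_norm (h t - \val y) < Num.min a b.
  have := unitI_ge0 t; have := unitI_le1 t => t1 t0.
  have et0 : 0 <= e * uval t by rewrite mulr_ge0// ltW.
  rewrite /h addrC addKr addr0 row_normZr//.
  apply: le_lt_trans eN; rewrite -/N; apply: ler_pM => //; last by rewrite lerDl.
  by rewrite ler_piMr// ltW.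
have ch : continuous h.
  apply: add_continuous; first exact: cst_continuous.
  apply: scale_map_continuous; last exact: cst_continuous.
  apply: real_complex_continuous; apply: affine_continuous.
  exact: val_unitI_continuous.
have hI t : injective (h t ord0).
  by apply: bI; have := hb t; rewrite lt_min => /andP[].
have [q cq qh] := lift_config ch hI.
have q0 : q zero = y.
  by apply: val_inj; rewrite qh /h val0E mulr0 addr0 scale0r addr0.
exists (q one), (mk_path cq q0 erefl); split.
  apply: (gV _ (e%:C)%C) => //; rewrite qh /h val1E mulr1 addr0//.
by move=> t; apply: aW; rewrite /= qh; have := hb t; rewrite lt_min => /andP[].
Qed.

Lemma conv_lt (r t u v : R) : 0 <= t -> t <= 1 -> u < r -> v < r ->
  (1 - t) * u + t * v < r.
Proof.
move=> t0 t1 ur vr; pose w := Num.max u v.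
have wr : w < r by rewrite gt_max ur.
apply: le_lt_trans wr; rewrite -[leRHS]mul1r -[X in _ <= X * w](subrK t 1) [leRHS]mulrDl.
apply: lerD; apply: ler_wpM2l; rewrite ?subr_ge0// le_max lexx ?orbT//.
Qed.

Lemma conv_row_norm_lt (r t : R) (u v : 'rV[C]_m) : 0 <= t -> t <= 1 ->
  row_norm u < r -> row_norm v < r ->
  row_norm (((1 - t)%:C)%C *: u + (t%:C)%C *: v) < r.
Proof.
move=> t0 t1 ur vr; have t1' : 0 <= 1 - t by lra.
apply: (le_lt_trans (row_normD _ _)); rewrite !row_normZr//.
exact: conv_lt.
Qed.

(** A point of the arc is a convex combination of [u] and [v] plus a multiple of [v - u] by an
    imaginary factor of modulus at most [e]. *)
Lemma detour_row_norm_lt (r e t : R) (u v : 'rV[C]_m) :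
  0 <= t -> t <= 1 -> 0 <= e ->
  row_norm u + e * row_norm (v - u) < r ->
  row_norm v + e * row_norm (v - u) < r ->
  row_norm (u + detour e t *: (v - u)) < r.
Proof.
move=> t0 t1 e0 ur vr; have t1' : 0 <= 1 - t by lra.
have -> : u + detour e t *: (v - u) = (((1 - t)%:C)%C *: u + (t%:C)%C *: v)
    + (((e * (t * (1 - t)))%:C)%C * 'i%C) *: (v - u).
  rewrite /detour scalerDl addrA; congr (_ + _).
  by rewrite scalerBr [in RHS]rmorphB rmorph1 scalerBl scale1r addrCA addrC.
apply: (le_lt_trans (row_normD _ _)).
have et : 0 <= e * (t * (1 - t)) by rewrite !mulr_ge0.
rewrite row_normZi//.
have := row_normD (((1 - t)%:C)%C *: u) ((t%:C)%C *: v); rewrite !row_normZr//.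
have := row_norm_ge0 (v - u).
set U := row_norm u in ur *; set W := row_norm v in vr *.
set D := row_norm (v - u) in ur vr *; move=> D0 hs.
have tt : t * (1 - t) <= 1 by nra.
have eD : e * (t * (1 - t)) * D <= e * D.
  by rewrite ler_wpM2r// ler_piMr.
have := conv_lt t0 t1 ur vr.
by lra.
Qed.

(** Balls are convex, and all vectors of a small ball around [y] are configurations, so [p] deforms
    linearly inside it to a detour arc with the same ends. In the unordered case [W] is a set on
    which the projection is injective. *)
Lemma line_dense_local (V : set O) : line_dense V ->
  forall y W, nbhs y W -> exists N, [/\ open N, N y, N `<=` W &
     forall x z (p : ipath x z), V x -> V z -> (forall t, N (p t)) ->
       homotopic_into V p].
Proof.
move=> dV y W /config_nbhsP[a a0 aW].
have [b b0 /separated_injective bI] := config_separated y.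
pose r := Num.min a b; have r0 : 0 < r by rewrite lt_min a0.
have {}bI (u : 'rV[C]_m) : row_norm (u - \val y) < r -> injective (u ord0).
  by rewrite lt_min => /andP[_ /bI].
pose B := [set z : O | row_norm (\val z - \val y) < r].
have yB : nbhs y B by exact: val_config_continuous (row_norm_nbhs _ r0).
exists B°; split => //; first exact: open_interior.
  by move=> z /interior_subset; rewrite /B /= lt_min => /andP[/aW].
move=> x z p Vx Vz pB'.
have pB t : row_norm (\val (p t) - \val y) < r by exact: interior_subset (pB' t).
have xr : row_norm (\val x - \val y) < r.
  by have := pB zero; rewrite path_zero.
have zr : row_norm (\val z - \val y) < r.
  by have := pB one; rewrite path_one.
have [g g0 gV] := dV (\val x) z Vz.
set X := row_norm _ in xr; set Z := row_norm _ in zr.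
pose D := row_norm (\val z - \val x); have D0 : 0 <= D := row_norm_ge0 _.
have D1 : 0 < D + 1 by rewrite ltr_wpDl.
(* The room left between the ends and the boundary of the ball bounds the bulge of the arc. *)
have d0 : 0 < Num.min (r - X) (r - Z) / (D + 1).
  by rewrite divr_gt0// lt_min !subr_gt0 xr.
have [e /andP[e0]] := detour_avoids g0 d0.
rewrite ltr_pdivlMr// lt_min => /andP[eX eZ] ge.
pose q (t : R) := \val x + detour e t *: (\val z - \val x).
have q0 : q 0 = \val x.
  by rewrite /q /detour mul0r mulr0 mul0r addr0 scale0r addr0.
have q1 : q 1 = \val z.
  by rewrite /q /detour subrr !mulr0 mul0r addr0 scale1r addrC subrK.
have qr t : 0 <= t -> t <= 1 -> row_norm (q t - \val y) < r.
  move=> t0 t1; rewrite /q addrAC.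
  have {1}-> : \val z - \val x = (\val z - \val y) - (\val x - \val y).
    by rewrite opprB addrA subrK.
  have zx : \val z - \val y - (\val x - \val y) = \val z - \val x.
    by rewrite opprB addrA subrK.
  by apply: detour_row_norm_lt; rewrite ?zx -/X -/Z -/D //; nra.
pose h (st : I * I) : 'rV[C]_m :=
  ((1 - uval st.1)%:C)%C *: \val (p st.2) + ((uval st.1)%:C)%C *: q (uval st.2).
have hr st : row_norm (h st - \val y) < r.
  have -> : h st - \val y = ((1 - uval st.1)%:C)%C *: (\val (p st.2) - \val y)
      + ((uval st.1)%:C)%C *: (q (uval st.2) - \val y).
    rewrite /h !scalerBr addrACA -opprD -scalerDl -rmorphD subrK.
    by rewrite rmorph1 scale1r.
  apply: conv_row_norm_lt; [exact: unitI_ge0|exact: unitI_le1|exact: pB|].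
  by apply: qr; [exact: unitI_ge0|exact: unitI_le1].
have ch : continuous h.
  have cs : continuous (fun st : I * I => uval st.1).
    by apply: val_continuous; exact: fst_cont.
  have ct : continuous (fun st : I * I => uval st.2).
    by apply: val_continuous; exact: snd_cont.
  apply: add_continuous; apply: scale_map_continuous.
  - by apply: real_complex_continuous; exact: onem_continuous.
  - apply: (@comp_continuous _ O _ (fun st : I * I => p st.2) _ _ val_config_continuous).
    by apply: comp_continuous; [exact: snd_cont|exact: cts_fun].
  - exact: real_complex_continuous.
  - apply: add_continuous; first exact: cst_continuous.
    apply: scale_map_continuous; last exact: cst_continuous.
    apply: (@add_continuous _ C^o); first exact: real_complex_continuous.
    apply: mul_map_continuous; last exact: cst_continuous.
    apply: real_complex_continuous; apply: mul_map_continuous.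
      exact: cst_continuous.
    by apply: mul_map_continuous => //; exact: onem_continuous.
have [H cH HE] := lift_config ch (fun st => bI _ (hr st)).
have Hx s : H (s, zero) = x.
  apply: val_inj; rewrite HE /h /= path_zero val0E q0 -scalerDl -rmorphD.
  by rewrite subrK rmorph1 scale1r.
have Hz s : H (s, one) = z.
  apply: val_inj; rewrite HE /h /= path_one val1E q1 -scalerDl -rmorphD.
  by rewrite subrK rmorph1 scale1r.
have cH1 : continuous (fun t : I => H (one, t)).
  apply: comp_continuous cH; apply: pair_continuous => [|t]; last exact: cvg_id.
  exact: cst_continuous.
exists (mk_path cH1 (Hx one) (Hz one)).
  exists H; split => // t; apply: val_inj; rewrite HE /h /= val0E.
  by rewrite subr0 scale1r scale0r addr0.
move=> t; have HV : \val (H (one, t)) = q (uval t).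
  by rewrite HE /h /= val1E subrr scale0r scale1r add0r.
rewrite /= /mk_path.
(* At the ends of the arc [g] may vanish, but there [V x] and [V z] hold by hypothesis. *)
have [t0|t0] := eqVneq (uval t) 0.
  by suff -> : H (one, t) = x by []; apply: val_inj; rewrite HV t0 q0.
have [t1|t1] := eqVneq (uval t) 1.
  by suff -> : H (one, t) = z by []; apply: val_inj; rewrite HV t1 q1.
exact: gV HV (ge _ t0 t1).
Qed.
End ordered_config_topology.

(** * Unordered configurations *)

Section unordered_config_topology.
Context (R : realType) (m : nat).
Local Notation C := R[i].
Local Notation I := (unitI R).
Local Notation O := (ordered_config R m).
Local Notation U := (unordered_config R m).
Local Notation proj := (@config_proj R m).

Lemma config_proj_continuous : continuous proj.
Proof. exact: pi_continuous. Qed.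

HB.instance Definition _ := isContinuous.Build O U proj config_proj_continuous.

Lemma config_proj_surj (y : U) : exists w, y = proj w.
Proof. by exists (repr y); rewrite /config_proj reprK. Qed.

Lemma col_perm_continuous (s : 'S_m) :
  continuous (col_perm s : 'rV[C]_m -> 'rV[C]_m).
Proof.
move=> v A /nbhs_ballP[e /= e0 eA]; apply/nbhs_ballP; exists e => // u [_ vu].
by apply: eA; split => // i j; rewrite !mxE; exact: vu.
Qed.

Lemma permute_config : exists2 f : 'S_m -> O -> O,
  forall s, continuous (f s) & forall s z, \val (f s z) = col_perm s (\val z).
Proof.
have inj s (z : O) : injective (col_perm s (\val z) ord0).
  by move=> i j; rewrite !mxE => /config_val_inj/perm_inj.
exists (fun s z => exist _ (col_perm s (\val z)) (mem_set (inj s z))) => // s.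
apply: continuous_comp_initial.
apply: (comp_continuous (@val_config_continuous R m)).
exact: col_perm_continuous.
Qed.

(** The preimage of the image of [A] is the union of the preimages of [A] under all permutations. *)
Lemma config_proj_open (A : set O) : open A -> open (proj @` A).
Proof.
move=> oA; rewrite /open/= /quotient_open.
have [f fc fE] := permute_config.
suff -> : \pi_U @^-1` (proj @` A) = \bigcup_s (f s @^-1` A).
  by apply: bigcup_open => s _; move/continuousP: (fc s); exact.
apply/seteqP; split=> [z [w Aw /config_projP[s ws]]|z [s _ Afz]].
  exists s => //; rewrite /preimage/=.
  by suff -> : f s z = w by []; apply: val_inj; rewrite fE ws.
by exists (f s z) => //; apply/config_projP; exists s.
Qed.

(** A permutation moving some index would equate coordinates at distinct indices of two vectors near
    [y], against [config_separated]. *)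
Lemma config_proj_locally_inj (y : O) : exists2 W, nbhs y W &
  {in W &, injective proj}.
Proof.
have [e e0 sep] := config_separated y.
exists [set z | row_norm (\val z - \val y) < e].
  exact: val_config_continuous (row_norm_nbhs _ e0).
move=> z w; rewrite !inE /= => ze we /config_projP[s zs].
apply: val_inj; rewrite zs; suff -> : s = 1%g by rewrite col_perm1.
apply/permP => i; rewrite perm1; apply/eqP; apply: contraT.
rewrite eq_sym => /(sep _ _ ze we).
by rewrite zs mxE eqxx.
Qed.

(* Paths in the image of a small open set lift, since the projection is open
   and locally injective. *)
Lemma lift_path (N : set O) (x z : U) (p : {path I from x to z in U}) :
  open N -> {in N &, injective proj} -> (forall t, (proj @` N) (p t)) ->
  exists2 l : I -> O, continuous l & forall t, N (l t) /\ proj (l t) = p t.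
Proof.
move=> oN inj pN.
have /choice[l lP] : forall t, exists w, N w /\ proj w = p t.
  by move=> t; have [w Nw wp] := pN t; exists w.
exists l => // t A; rewrite nbhsE => -[B [oB Bl] BA].
have oNB : open (proj @` (N `&` B)) by apply: config_proj_open; exact: openI.
have : nbhs t (p @^-1` (proj @` (N `&` B))).
  apply: (cts_fun (s := p)); apply: open_nbhs_nbhs; split => //.
  by exists (l t); [split => //; case: (lP t)|case: (lP t)].
apply: filterS => r [w [Nw Bw] wp]; apply: BA.
have [Nl lp] := lP r.
by suff -> : l r = w by []; apply: inj; rewrite ?inE// lp wp.
Qed.

Theorem ordered_homotopic_into (V : set O) (v : O) :
  line_dense V -> V v ->
  forall x z (p : {path I from x to z in O}), V x -> V z -> homotopic_into V p.
Proof.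
move=> dV Vv; apply: local_homotopic_into; first exact: line_dense_escape Vv.
move=> y; have [N [oN Ny _ hN]] := line_dense_local dV (@filterT _ (nbhs y) _).
by exists N.
Qed.

(** Both hypotheses of [local_homotopic_into] are obtained upstairs: an escaping path is projected,
    and a short path is lifted, deformed and projected. *)
Theorem unordered_homotopic_into (V : set U) (v : U) :
  line_dense (proj @^-1` V) -> V v ->
  forall x z (p : {path I from x to z in U}), V x -> V z -> homotopic_into V p.
Proof.
move=> dV Vv; apply: local_homotopic_into => [y W yW|y].
  have [w wy] := config_proj_surj y; have [u uv] := config_proj_surj v.
  subst y; have Wu : (proj @^-1` V) u by rewrite /= -uv.
  have /(line_dense_escape dV Wu)[z [q [Vz Wq]]] : nbhs w (proj @^-1` W).
    exact: config_proj_continuous.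
  by exists (proj z), (proj \o q).
have [w wy] := config_proj_surj y; subst y.
have [W wW inj] := config_proj_locally_inj w.
have [N [oN Nw NW hN]] := line_dense_local dV wW.
exists (proj @` N); split; [exact: config_proj_open|by exists w|].
move=> x z p Vx Vz pN.
have injN : {in N &, injective proj}.
  by move=> a b; rewrite !inE => /NW Wa /NW Wb; apply: inj; rewrite inE.
have [l cl lP] := lift_path oN injN pN.
pose lp : {path I from l zero to l one in O} := mk_path cl erefl erefl.
have [||t|q lq Vq] := hN _ _ lp.
- by rewrite /= (lP zero).2 path_zero.
- by rewrite /= (lP one).2 path_one.
- by case: (lP t).
apply: (@homotopic_into_eq _ _ _ _ _ _ _ _ (proj \o lp)).
  by move=> t; rewrite /= (lP t).2.
exact: homotopic_into_comp lq Vq.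
Qed.

End unordered_config_topology.

(* Surjectivity on fundamental groups *)
Local Close Scope ring_scope.

Theorem proposition1p8 (R : realType) (n : nat) (hn : (2 <= n)%N) :
  [/\ forall b : QF R n,
        set_surj [set: pi1 R b] [set: pi1 R (inclusion (QF R n) b)]
          (pi1_map R (inclusion (QF R n)) b),
      forall b : QC R n,
        set_surj [set: pi1 R b] [set: pi1 R (inclusion (QC R n) b)]
          (pi1_map R (inclusion (QC R n)) b),
      forall b : RF R n,
        set_surj [set: pi1 R b] [set: pi1 R (inclusion (RF R n) b)]
          (pi1_map R (inclusion (RF R n)) b) &
      forall b : RC R n,
        set_surj [set: pi1 R b] [set: pi1 R (inclusion (RC R n) b)]
          (pi1_map R (inclusion (RC R n)) b)].
Proof.
have n0 : (0 < n)%N by exact: ltnW.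
have bV (T : topologicalType) (V : set T) (b : V) : V (inclusion V b).
  exact: set_mem (valP b).
(* A loop at [b] has both ends in the subset, and [b] also supplies the point of the subset through
   which the lines pass. *)
split=> b; apply: pi1_inclusion_surj => p.
- by apply: (ordered_homotopic_into (@QF_line_dense R n) (bV _ _ b)); exact: bV.
- by apply: (unordered_homotopic_into (@QF_line_dense R n) (bV _ _ b)); exact: bV.
- by apply: (ordered_homotopic_into (RF_line_dense n0) (bV _ _ b)); exact: bV.
- by apply: (unordered_homotopic_into (RF_line_dense n0) (bV _ _ b)); exact: bV.
Qed.
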